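(* For $1<\alpha,\beta\le2$ let $(\lambda_1,\lambda_2,\lambda_3)$ (possibly depending on $\alpha$) be chosen in $\mathcal{S}_1(\alpha)$ or $\mathcal{S}_2(\alpha)$ or $\mathcal{S}_3(\alpha)$, and $(\gamma_1,\gamma_2,\gamma_3)$ (possibly depending on $\beta$) be chosen in $\mathcal{S}_1(\beta)$ or $\mathcal{S}_2(\beta)$ or $\mathcal{S}_3(\beta)$. For $\kappa\in(1,2]$ and real $\mu_1,\mu_2,\mu_3$ put $$Q(\theta,\kappa;\mu_1,\mu_2,\mu_3)=\Big(2\sin\frac{\theta}{2}\Big)^{\kappa}\Big(\mu_1\cos\big(\tfrac{\kappa}{2}(\theta-\pi)-\theta\big)+\mu_2\cos\big(\tfrac{\kappa}{2}(\theta-\pi)\big)+\mu_3\cos\big(\tfrac{\kappa}{2}(\theta-\pi)+\theta\big)\Big),$$ and assume that $Q(\theta_x,\alpha;\lambda_1,\lambda_2,\lambda_3)\le0$ and $Q(\theta_y,\beta;\gamma_1,\gamma_2,\gamma_3)\le0$ for all $\theta_x,\theta_y\in[0,\pi]$ and $1<\alpha,\beta\le2$. Then the difference scheme $$\Big(1-\frac{\tau}{2}\delta_x^{\alpha}\Big)\Big(1-\frac{\tau}{2}\delta_y^{\beta}\Big)U_{j,m}^{n+1}=\Big(1+\frac{\tau}{2}\delta_x^{\alpha}\Big)\Big(1+\frac{\tau}{2}\delta_y^{\beta}\Big)U_{j,m}^{n}+\tau f_{j,m}^{n+1/2}$$ is unconditionally (von Neumann) stable for $1<\alpha,\beta\l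e2$.
   Context: The scheme discretizes $u_t+v_x\partial_xu+v_y\partial_yu=d_x({}_aD_x^{\alpha}+{}_xD_b^{\alpha})u+d_y({}_cD_y^{\beta}+{}_yD_d^{\beta})u+f$ on $(a,b)\times(c,d)\times[0,T]$ with initial data and Dirichlet boundary data, where $1<\alpha,\beta\le2$, $d_x,d_y\ge0$ and $v_x,v_y>0$ are constants and the fractional operators are left/right Riemann–Liouville derivatives. The time step is $\tau>0$, the space steps are equal, $h=h_x=h_y>0$; $U_{j,m}^n$ approximates $u$ at the grid point $(x_j,y_m)$ and time $t_n=n\tau$, and $f_{j,m}^{n+1/2}=f(x_j,y_m,(t_n+t_{n+1})/2)$. Parameter sets, for $\kappa\in(1,2]$ (three parametrizations of the real solutions of $\mu_1+\mu_2+\mu_3=1$, $\mu_1-\mu_3=\frac{\kappa}{2}$): $\mathcal{S}_1(\kappa)$: $\mu_1$ given, $\mu_2=\frac{2+\kappa}{2}-2\mu_1$, $\mu_3=\mu_1-\frac{\kappa}{2}$; $\mathcal{S}_2(\kappa)$: $\mu_2$ given, $\mu_1=\frac{2+\kappa}{4}-\frac{\mu_2}{2}$, $\mu_3=\frac{2-\kappa}{4}-\frac{\mu_2}{2}$; $\mathcal{S}_3(\kappa)$: $\mu_3$ given, $\mu_1=\frac{\kappa}{2}+\mu_3$, $\mu_2=\frac{2-\kappa}{2}-2\mu_3$. Weights: $w_k^{(\kappa)}=(-1)^k\binom{\kappa}{k}$. Let $g_0^{(\alpha)}=\lambda_1w_0^{(\alpha)}$, $g_1^{(\alpha)}=\lambda_1w_1^{(\alpha)}+\lambda_2w_0^{(\alpha)}$,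 $g_k^{(\alpha)}=\lambda_1w_k^{(\alpha)}+\lambda_2w_{k-1}^{(\alpha)}+\lambda_3w_{k-2}^{(\alpha)}$ for $k\ge2$, and let $\tilde g_k^{(\beta)}$ be defined in the same way from $w_k^{(\beta)}$ and $(\gamma_1,\gamma_2,\gamma_3)$. Discrete operators. For grid functions extended by zero to the whole lattice $(j,m)\in\mathbb{Z}^2$ (so that the sums run to infinity), $$\delta_x^{\alpha}U_{j,m}=\frac{d_x}{h^{\alpha}}\sum_{k=0}^{\infty}g_k^{(\alpha)}\big(U_{j-k+1,m}+U_{j+k-1,m}\big)-v_x\frac{U_{j+1,m}-U_{j-1,m}}{2h},$$ $$\delta_y^{\beta}U_{j,m}=\frac{d_y}{h^{\beta}}\sum_{k=0}^{\infty}\tilde g_k^{(\beta)}\big(U_{j,m-k+1}+U_{j,m+k-1}\big)-v_y\frac{U_{j,m+1}-U_{j,m-1}}{2h}.$$ Von Neumann stability: insert $\epsilon_{j,m}^n=\rho^ne^{i(\theta_xj+\theta_ym)}$ ($i=\sqrt{-1}$) into the error equation $(1-\frac{\tau}{2}\delta_x^{\alpha})(1-\frac{\tau}{2}\delta_y^{\beta})\epsilon_{j,m}^{n+1}=(1+\frac{\tau}{2}\delta_x^{\alpha})(1+\frac{\tau}{2}\delta_y^{\beta})\epsilon_{j,m}^{n}$ on the whole lattice; this determines the amplification factor $G(\theta_x,\theta_y)=\rho^{n+1}/\rho^{n}$. The scheme is unconditionally stable if, for every $\tau>0$ and $h>0$, $|G(\theta_x,\theta_y)|\le1$ for all $\theta_x,\theta_y\in[-\pi,\pi]$.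 *)

(* Defs.v *)
From Stdlib Require Import Reals ZArith.
From Coquelicot Require Import Coquelicot.

Open Scope R_scope.

(* Stdlib's [Rpower 0 y] equals 1; here the base [2 sin (theta/2)] vanishes at
   [theta = 0] and the exponent is positive, so [0 ^ y] must be 0. *)
Definition rpow (x y : R) : R := if Rlt_dec 0 x then Rpower x y else 0.

Record triple : Type := Triple { mu1 : R; mu2 : R; mu3 : R }.

Definition S1 (kappa : R) (mu : triple) : Prop :=
  mu2 mu = (2 + kappa) / 2 - 2 * mu1 mu /\ mu3 mu = mu1 mu - kappa / 2.

Definition S2 (kappa : R) (mu : triple) : Prop :=
  mu1 mu = (2 + kappa) / 4 - mu2 mu / 2 /\ mu3 mu = (2 - kappa) / 4 - mu2 mu / 2.

Definition S3 (kappa : R) (mu : triple) : Prop :=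
  mu1 mu = kappa / 2 + mu3 mu /\ mu2 mu = (2 - kappa) / 2 - 2 * mu3 mu.

Fixpoint falling (kappa : R) (k : nat) : R :=
  match k with
  | O => 1
  | S k' => falling kappa k' * (kappa - INR k')
  end.

Definition gbinom (kappa : R) (k : nat) : R := falling kappa k / INR (fact k).

Definition w (kappa : R) (k : nat) : R := (-1) ^ k * gbinom kappa k.

Definition g (kappa : R) (mu : triple) (k : nat) : R :=
  match k with
  | O => mu1 mu * w kappa 0
  | S O => mu1 mu * w kappa 1 + mu2 mu * w kappa 0
  | S (S k') =>
      mu1 mu * w kappa (S (S k')) + mu2 mu * w kappa (S k') + mu3 mu * w kappa k'
  end.

(* Sum of a complex series, meaningful when the series converges; see
   [CSeries_correct]. *)
Definition CSeries (a : nat -> C) : C :=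
  (Series (fun k => Re (a k)), Series (fun k => Im (a k))).

Lemma CSeries_correct (a : nat -> C) (l : C) :
  @is_series C_AbsRing C_NormedModule a l -> CSeries a = l.
Proof.
intros H.
assert (Hre : is_series (fun k => Re (a k)) (Re l)).
{ apply (filterlim_ext (fun n => Re (sum_n a n))).
  - intros n; induction n as [|n IH].
    + now rewrite !sum_O.
    + rewrite !sum_Sn, <- IH; reflexivity.
  - intros P [eps HP].
    apply (H (fun z => P (Re z))).
    exists eps; intros z [Hz _]; apply HP; exact Hz. }
assert (Him : is_series (fun k => Im (a k)) (Im l)).
{ apply (filterlim_ext (fun n => Im (sum_n a n))).
  - intros n; induction n as [|n IH].
    + now rewrite !sum_O.
    + rewrite !sum_Sn, <- IH; reflexivity.
  - intros P [eps HP].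
    apply (H (fun z => P (Im z))).
    exists eps; intros z [_ Hz]; apply HP; exact Hz. }
unfold CSeries.
rewrite (is_series_unique _ _ Hre), (is_series_unique _ _ Him).
destruct l; reflexivity.
Qed.

Definition grid : Type := Z -> Z -> C.

(* One-dimensional operator with diffusion [d], velocity [v], order [kappa];
   the weights are summable for [kappa > 1], so the series converges for every
   bounded [u]. *)
Definition delta1 (d v kappa : R) (mu : triple) (h : R) (u : Z -> C) (j : Z) : C :=
  (RtoC (d / Rpower h kappa) *
     CSeries (fun k => RtoC (g kappa mu k) *
                       (u (j - Z.of_nat k + 1)%Z + u (j + Z.of_nat k - 1)%Z))
   - RtoC v * ((u (j + 1)%Z - u (j - 1)%Z) / RtoC (2 * h)))%C.

Definition delta_x (dx vx alpha : R) (lam : triple) (h : R) (U : grid) : grid :=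
  fun j m => delta1 dx vx alpha lam h (fun i => U i m) j.

Definition delta_y (dy vy beta : R) (gam : triple) (h : R) (U : grid) : grid :=
  fun j m => delta1 dy vy beta gam h (fun i => U j i) m.

(* [1 + c * D] for an operator [D] on grid functions. *)
Definition id_plus (c : R) (D : grid -> grid) (U : grid) : grid :=
  fun j m => (U j m + RtoC c * D U j m)%C.

(* [F n j m] stands for [f (x_j, y_m, (t_n + t_{n+1}) / 2)]. *)
Definition difference_scheme (dx dy vx vy alpha beta : R) (lam gam : triple)
    (tau h : R) (F U : nat -> grid) : Prop :=
  let Dx := delta_x dx vx alpha lam h in
  let Dy := delta_y dy vy beta gam h in
  forall (n : nat) (j m : Z),
    id_plus (- (tau / 2)) Dx (id_plus (- (tau / 2)) Dy (U (S n))) j m =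
    (id_plus (tau / 2) Dx (id_plus (tau / 2) Dy (U n)) j m + RtoC tau * F n j m)%C.

(* The error is the difference of two solutions with the same source, hence
   solves the scheme with zero source. *)
Definition error_equation (dx dy vx vy alpha beta : R) (lam gam : triple)
    (tau h : R) (eps : nat -> grid) : Prop :=
  difference_scheme dx dy vx vy alpha beta lam gam tau h
    (fun _ _ _ => RtoC 0) eps.

Definition fourier_mode (rho : C) (thx thy : R) : nat -> grid :=
  fun n j m =>
    let phase := thx * IZR j + thy * IZR m in
    (rho ^ n * (cos phase, sin phase))%C.

(* [rho ^ (S n) / rho ^ n = rho], so the amplification factor is [rho]. *)
Definition amplification_factor (dx dy vx vy alpha beta : R) (lam gam : triple)
    (tau h thx thy : R) (rho : C) : Prop :=
  error_equation dx dy vx vy alpha beta lam gam tau h (fourier_mode rho thx thy).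

(* The error equation determines the factor [G]: it exists and is unique. *)
Definition unconditionally_stable (dx dy vx vy alpha beta : R)
    (lam gam : triple) : Prop :=
  forall tau h : R, 0 < tau -> 0 < h ->
  forall thx thy : R, - PI <= thx <= PI -> - PI <= thy <= PI ->
  exists G : C,
    (forall rho : C,
       amplification_factor dx dy vx vy alpha beta lam gam tau h thx thy rho
       <-> rho = G) /\
    Cmod G <= 1.

Definition Q (theta kappa : R) (mu : triple) : R :=
  rpow (2 * sin (theta / 2)) kappa *
  (mu1 mu * cos (kappa / 2 * (theta - PI) - theta) +
   mu2 mu * cos (kappa / 2 * (theta - PI)) +
   mu3 mu * cos (kappa / 2 * (theta - PI) + theta)).

(* Main.v *)
Require Import Defs.
From Stdlib Require Import Reals.
From Coquelicot Require Import Coquelicot.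
From Stdlib Require Import Lra Lia.
Open Scope R_scope.

(** The operators are invariant under translation of the lattice, so they act on
    the mode e^(i (thx j + thy m)) by multiplication with a number, the symbol
    s. The error equation for the mode becomes the scalar equation
<<
  (1 - tau/2 s_x) (1 - tau/2 s_y) rho = (1 + tau/2 s_x) (1 + tau/2 s_y),
>>
    and everything follows from Re s_x <= 0 and Re s_y <= 0: then
    Re (1 - tau/2 s) >= 1, so the left factors do not vanish and rho is
    determined, and |1 + tau/2 s| <= |1 - tau/2 s|, so |rho| <= 1
    ([one_minus_neq_0], [Cmod_one_plus_le]).

    Convection contributes only - i v sin theta / h to the symbol. In the
    diffusion sum the two opposite shifts combine to 2 cos ((k - 1) theta), so
    its contribution is a nonnegative multiple of
    sum_k g_k cos ((k - 1) theta), an even function of theta. The heart of the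
    proof is that on [0, PI] this sum equals Q ([is_series_g_cos]), whose sign
    is the hypothesis.

    With z = e^(i theta), summing the definition of g gives
<<
  sum_k g_k z^(k-1) = (mu1 z^-1 + mu2 + mu3 z) sum_k w_k z^k,
>>
    and sum_k w_k z^k = (1 - z)^kappa with
    1 - z = 2 sin (theta/2) e^(i (theta - PI)/2); the real part is Q. The
    binomial series is needed on the unit circle, the boundary of its disk of
    convergence ([binomial_series_circle]). There it converges absolutely, since
    w_k >= 0 for k >= 2 while the partial sums of the w_k are nonpositive
    from k = 2 on ([ex_series_Rabs_w]). Along a radius
    F(r) = sum_k w_k z^k r^k satisfies (1 - r z) F' = - kappa z F, which
    identifies it with (1 - r z)^kappa for r < 1 ([binomial_series_disk]), and
    Abel's theorem carries the identity to r = 1. *)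

(** Equations between terms of series are typed at the carrier of an algebraic
    structure over R, where [ring] does not recognise the real operations. *)
Ltac real_eq := match goal with |- ?x = ?y => change (@eq R x y) end.

(** * The binomial weights *)

Lemma w_0 (kappa : R) : w kappa 0 = 1.
Proof. unfold w, gbinom; simpl; field. Qed.

Lemma w_succ (kappa : R) (k : nat) :
  INR (S k) * w kappa (S k) = (INR k - kappa) * w kappa k.
Proof.
unfold w, gbinom.
rewrite fact_simpl, mult_INR; simpl falling; simpl pow.
field; split; [apply INR_fact_neq_0 | now apply not_0_INR].
Qed.

Lemma w_nonneg (kappa : R) (k : nat) : 1 <= kappa <= 2 -> 0 <= w kappa (S (S k)).
Proof.
intros Hk; induction k as [|k IH].
- pose proof (w_succ kappa 0) as H0; pose proof (w_succ kappa 1) as H1.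
  rewrite w_0 in H0; simpl in H0, H1; nra.
- pose proof (w_succ kappa (S (S k))) as H.
  rewrite !S_INR in H; pose proof (pos_INR k); nra.
Qed.

(** The partial sums are again binomial weights, of order [kappa - 1]; here they
    are expressed through [w kappa n] itself. *)
Lemma sum_w (kappa : R) (n : nat) :
  kappa * sum_n (w kappa) n = w kappa n * (kappa - INR n).
Proof.
induction n as [|n IH].
- rewrite sum_O; simpl; ring.
- rewrite sum_Sn; change plus with Rplus.
  pose proof (w_succ kappa n) as H; rewrite S_INR in *; nra.
Qed.

(** From k = 2 on the weights are nonnegative, so only boundedness is at stake:
    by [sum_w] the sum up to n + 2 is nonpositive, and its first two terms add
    up to [1 - kappa]. *)
Lemma ex_series_Rabs_w (kappa : R) :
  1 <= kappa <= 2 -> ex_series (fun k => Rabs (w kappa k)).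
Proof.
intros Hk.
apply (ex_series_incr_n (fun k => Rabs (w kappa k)) 2).
apply (ex_series_ext (fun k => w kappa (S (S k)))).
{ intros k; rewrite Rabs_pos_eq by now apply w_nonneg. reflexivity. }
apply ex_finite_lim_seq_incr with (M := kappa - 1).
- intros n; rewrite sum_Sn; change plus with Rplus.
  pose proof (w_nonneg kappa (S n) Hk); lra.
- intros n.
  assert (E : sum_n (w kappa) (S (S n)) =
              1 - kappa + sum_n (fun k => w kappa (S (S k))) n).
  { induction n as [|n IH].
    - rewrite !sum_Sn, !sum_O; change plus with Rplus.
      pose proof (w_succ kappa 0) as H0; rewrite w_0 in *; simpl in H0; lra.
    - rewrite sum_Sn, IH, (sum_Sn _ n); change plus with Rplus.
      real_eq; ring. }
  pose proof (sum_w kappa (S (S n))) as H; rewrite E in H.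
  pose proof (w_nonneg kappa n Hk) as Hw; rewrite !S_INR in H.
  pose proof (pos_INR n) as Hn.
  set (X := sum_n _ n) in *.
  assert (w kappa (S (S n)) * (kappa - (INR n + 1 + 1)) <= 0) by nra.
  apply Rnot_lt_le; intros HX; change (kappa - 1 < X) in HX; nra.
Qed.

Lemma Rabs_mult_le_l (x y : R) : Rabs y <= 1 -> Rabs (x * y) <= Rabs x.
Proof. intros Hy; rewrite Rabs_mult; pose proof (Rabs_pos x); nra. Qed.

Lemma Rabs_cos_le_1 (x : R) : Rabs (cos x) <= 1.
Proof. apply Rabs_le, COS_bound. Qed.

Lemma Rabs_sin_le_1 (x : R) : Rabs (sin x) <= 1.
Proof. apply Rabs_le, SIN_bound. Qed.

Lemma ex_series_Rabs_w_mult (kappa : R) (t : nat -> R) :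
  1 <= kappa <= 2 -> (forall k, Rabs (t k) <= 1) ->
  ex_series (fun k => Rabs (w kappa k * t k)).
Proof.
intros Hk Ht.
apply (@ex_series_le R_AbsRing R_CompleteNormedModule _
         (fun k => Rabs (w kappa k))).
- intros n. change (Rabs (Rabs (w kappa n * t n)) <= Rabs (w kappa n)).
  rewrite Rabs_Rabsolu; now apply Rabs_mult_le_l.
- now apply ex_series_Rabs_w.
Qed.

(** * Absolutely summable coefficients and Abel's theorem *)

Lemma CV_radius_ge_1 (a : nat -> R) :
  ex_series (fun k => Rabs (a k)) -> Rbar_le 1 (CV_radius a).
Proof.
intros H; unfold CV_radius.
apply (proj1 (Lub_Rbar_correct (CV_disk a))).
revert H; apply ex_series_ext; intros n.
now rewrite pow1, Rmult_1_r.
Qed.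

Lemma filterlim_at_left_of_continuous (X : R -> R) (x : R) :
  continuous X x -> filterlim X (at_left x) (locally (X x)).
Proof.
intros H; apply (filterlim_filter_le_1 (F := locally x)); [|exact H].
intros S HS; revert HS; apply filter_le_within.
Qed.

(** Abel's theorem concerns the boundary of the disk of convergence; when the
    radius exceeds 1 (as for [kappa = 2], where the weights are eventually 0)
    the point 1 is interior and continuity suffices. *)
Lemma PSeries_lim_1 (a : nat -> R) :
  ex_series (fun k => Rabs (a k)) ->
  filterlim (PSeries a) (at_left 1) (locally (PSeries a 1)).
Proof.
intros H.
assert (Hr := CV_radius_ge_1 a H).
destruct (Rbar_le_lt_or_eq_dec _ _ Hr) as [Hlt|Heq].
- apply filterlim_at_left_of_continuous, continuity_pt_filterlim, PSeries_continuity.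
  rewrite Rabs_R1; exact Hlt.
- assert (HA := Abel a). rewrite <- Heq in HA. apply HA.
  + simpl; lra.
  + exact I.
  + apply ex_pseries_R.
    apply ex_series_Rabs in H. revert H; apply ex_series_ext; intros n.
    simpl; rewrite pow1; symmetry; apply Rmult_1_r.
Qed.

(** * The binomial series inside the disk *)

(** With F = A + i B the hypotheses say F' = (l + i p) F, (L + i P)' = l + i p.
    Hence F e^(- (L + i P)) is constant; this is its real part. *)
Lemma polar_first_integral (A B L P l p : R -> R) (r : R) :
  0 <= r ->
  (forall t, 0 <= t <= r -> is_derive A t (l t * A t - p t * B t)) ->
  (forall t, 0 <= t <= r -> is_derive B t (l t * B t + p t * A t)) ->
  (forall t, 0 <= t <= r -> is_derive L t (l t)) ->
  (forall t, 0 <= t <= r -> is_derive P t (p t)) ->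
  L 0 = 0 -> P 0 = 0 ->
  exp (- L r) * (A r * cos (P r) + B r * sin (P r)) = A 0.
Proof.
intros Hr HA HB HL HP L0 P0.
assert (H0 : exp (- L 0) * (A 0 * cos (P 0) + B 0 * sin (P 0)) = A 0).
{ rewrite L0, P0, Ropp_0, exp_0, cos_0, sin_0; ring. }
destruct Hr as [Hr|<-]; [|exact H0].
rewrite <- H0; symmetry.
apply (eq_is_derive
  (fun t => exp (- L t) * (A t * cos (P t) + B t * sin (P t))) 0 r); [|exact Hr].
intros t Ht.
specialize (HA t Ht); specialize (HB t Ht); specialize (HL t Ht); specialize (HP t Ht).
assert (EA : Derive (fun x : R => A x) t = _) by exact (is_derive_unique _ _ _ HA).
assert (EB : Derive (fun x : R => B x) t = _) by exact (is_derive_unique _ _ _ HB).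
assert (EL : Derive (fun x : R => L x) t = _) by exact (is_derive_unique _ _ _ HL).
assert (EP : Derive (fun x : R => P x) t = _) by exact (is_derive_unique _ _ _ HP).
auto_derive.
- repeat split; eexists; eassumption.
- rewrite EA, EB, EL, EP; change zero with 0; ring.
Qed.

Lemma exp_polar_of_ode (A B L P l p : R -> R) (r : R) :
  0 <= r ->
  (forall t, 0 <= t <= r -> is_derive A t (l t * A t - p t * B t)) ->
  (forall t, 0 <= t <= r -> is_derive B t (l t * B t + p t * A t)) ->
  (forall t, 0 <= t <= r -> is_derive L t (l t)) ->
  (forall t, 0 <= t <= r -> is_derive P t (p t)) ->
  A 0 = 1 -> B 0 = 0 -> L 0 = 0 -> P 0 = 0 ->
  A r = exp (L r) * cos (P r) /\ B r = exp (L r) * sin (P r).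
Proof.
intros Hr HA HB HL HP A0 B0 L0 P0.
pose proof (polar_first_integral A B L P l p r Hr HA HB HL HP L0 P0) as HM.
(* Multiplication by - i turns F = A + i B into B - i A and preserves the
   equation. *)
assert (HN : exp (- L r) * (B r * cos (P r) + - A r * sin (P r)) = B 0).
{ apply (polar_first_integral B (fun t => - A t) L P l p r); try assumption.
  - intros t Ht; replace (_ - _) with (l t * B t + p t * A t) by ring; auto.
  - intros t Ht; replace (_ + _) with (- (l t * A t - p t * B t)) by ring.
    apply (is_derive_opp A t (l t * A t - p t * B t)); auto. }
rewrite A0 in HM; rewrite B0 in HN.
assert (HE : exp (L r) * exp (- L r) = 1).
{ rewrite <- exp_plus, Rplus_opp_r; apply exp_0. }
pose proof (sin2_cos2 (P r)) as Hsc; unfold Rsqr in Hsc.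
set (E := exp (L r)) in *; set (E' := exp (- L r)) in *.
set (c := cos (P r)) in *; set (s := sin (P r)) in *.
split.
- transitivity (E * (E' * (A r * c + B r * s)) * c - E * (E' * (B r * c + - A r * s)) * s).
  + replace (_ - _) with (A r * (E * E') * (s * s + c * c)) by ring.
    rewrite HE, Hsc; ring.
  + rewrite HM, HN; ring.
- transitivity (E * (E' * (A r * c + B r * s)) * s + E * (E' * (B r * c + - A r * s)) * c).
  + replace (E * (E' * (A r * c + B r * s)) * s + E * (E' * (B r * c + - A r * s)) * c)
      with (B r * (E * E') * (s * s + c * c)) by ring.
    rewrite HE, Hsc; ring.
  + rewrite HM, HN; ring.
Qed.

(** Real and imaginary parts of the coefficients w_k e^(i k theta): a ray of the
    complex binomial series becomes a pair of real power series in the radius. *)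
Definition wcos (kappa theta : R) (k : nat) : R := w kappa k * cos (INR k * theta).
Definition wsin (kappa theta : R) (k : nat) : R := w kappa k * sin (INR k * theta).

Lemma ex_series_Rabs_wcos (kappa theta : R) :
  1 <= kappa <= 2 -> ex_series (fun k => Rabs (wcos kappa theta k)).
Proof.
intros Hk; apply ex_series_Rabs_w_mult; [exact Hk | intros k; apply Rabs_cos_le_1].
Qed.

Lemma ex_series_Rabs_wsin (kappa theta : R) :
  1 <= kappa <= 2 -> ex_series (fun k => Rabs (wsin kappa theta k)).
Proof.
intros Hk; apply ex_series_Rabs_w_mult; [exact Hk | intros k; apply Rabs_sin_le_1].
Qed.

Lemma lt_CV_radius (c : nat -> R) (r : R) :
  ex_series (fun k => Rabs (c k)) -> 0 <= r < 1 ->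
  Rbar_lt (Rabs r) (CV_radius c).
Proof.
intros Hc Hr; apply Rbar_lt_le_trans with 1; [|now apply CV_radius_ge_1].
simpl; rewrite Rabs_pos_eq; lra.
Qed.

Lemma is_series_PSeries (c : nat -> R) (r : R) :
  Rbar_lt (Rabs r) (CV_radius c) ->
  is_series (fun k => c k * r ^ k) (PSeries c r).
Proof.
intros Hi.
apply (proj1 (is_pseries_R c r (PSeries c r))), PSeries_correct, CV_radius_inside, Hi.
Qed.

(** The operator r d/dr multiplies the k-th coefficient by k, which is the shape
    in which the recursion [w_succ] enters the differential equation. *)
Lemma is_series_euler_derive (c : nat -> R) (r : R) :
  Rbar_lt (Rabs r) (CV_radius c) ->
  is_series (fun k => INR k * c k * r ^ k) (r * PSeries (PS_derive c) r).
Proof.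
intros Hi.
apply is_series_ext with (fun k => PS_incr_1 (PS_derive c) k * r ^ k).
{ intros [|k]; [|reflexivity].
  change (0 * r ^ 0 = 0 * c 0%nat * r ^ 0); ring. }
apply (proj1 (is_pseries_R (PS_incr_1 (PS_derive c)) r _)).
apply (is_pseries_incr_1 (K := R_AbsRing) (V := R_NormedModule)).
apply PSeries_correct, ex_pseries_derive, Hi.
Qed.

Lemma re_one_minus_pos (r theta : R) : 0 <= r < 1 -> 0 < 1 - r * cos theta.
Proof. intros Hr; pose proof (COS_bound theta); nra. Qed.

Lemma mod2_one_minus_pos (r theta : R) : 0 <= r < 1 -> 0 < 1 - 2 * r * cos theta + r ^ 2.
Proof. intros Hr; pose proof (COS_bound theta); nra. Qed.

(** The recursion (k + 1) w_(k+1) = (k - kappa) w_k says that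
    F = sum_k w_k z^k r^k, z = e^(i theta), satisfies
    F' = z (r F' - kappa F). Solved for F', with D = |1 - r z|^2, this is
    F' = (l + i p) F. *)
Lemma binomial_ode (kappa theta r : R) : 1 <= kappa <= 2 -> 0 <= r < 1 ->
  let A := PSeries (wcos kappa theta) r in
  let B := PSeries (wsin kappa theta) r in
  let D := 1 - 2 * r * cos theta + r ^ 2 in
  let l := kappa * (r - cos theta) / D in
  let p := - kappa * sin theta / D in
  PSeries (PS_derive (wcos kappa theta)) r = l * A - p * B /\
  PSeries (PS_derive (wsin kappa theta)) r = l * B + p * A.
Proof.
intros Hk Hr A B D l p.
assert (Ia := lt_CV_radius _ _ (ex_series_Rabs_wcos kappa theta Hk) Hr).
assert (Ib := lt_CV_radius _ _ (ex_series_Rabs_wsin kappa theta Hk) Hr).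
pose proof (is_series_PSeries _ _ Ia) as Ha.
pose proof (is_series_PSeries _ _ Ib) as Hb.
pose proof (is_series_euler_derive _ _ Ia) as Ha'.
pose proof (is_series_euler_derive _ _ Ib) as Hb'.
fold A in Ha; fold B in Hb.
set (A' := PSeries (PS_derive (wcos kappa theta)) r) in *.
set (B' := PSeries (PS_derive (wsin kappa theta)) r) in *.
pose proof (is_series_minus _ _ _ _ Ha' (is_series_scal_l kappa _ _ Ha)) as Ha1.
pose proof (is_series_minus _ _ _ _ Hb' (is_series_scal_l kappa _ _ Hb)) as Hb1.
assert (Ea : A' = cos theta * (r * A' - kappa * A) -
                  sin theta * (r * B' - kappa * B)).
{ apply is_pseries_unique, (proj2 (is_pseries_R _ _ _)).
  apply is_series_ext with (fun k =>
    cos theta * (INR k * wcos kappa theta k * r ^ k - kappa * (wcos kappa theta k * r ^ k)) -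
    sin theta * (INR k * wsin kappa theta k * r ^ k - kappa * (wsin kappa theta k * r ^ k))).
  { intros k.
    transitivity (INR (S k) * w kappa (S k) * cos (INR (S k) * theta) * r ^ k).
    - real_eq.
      rewrite w_succ, S_INR, Rmult_plus_distr_r, Rmult_1_l, cos_plus.
      unfold wcos, wsin; ring.
    - unfold PS_derive, wcos; real_eq; ring. }
  exact (is_series_minus _ _ _ _ (is_series_scal_l (cos theta) _ _ Ha1)
                                 (is_series_scal_l (sin theta) _ _ Hb1)). }
assert (Eb : B' = sin theta * (r * A' - kappa * A) +
                  cos theta * (r * B' - kappa * B)).
{ apply is_pseries_unique, (proj2 (is_pseries_R _ _ _)).
  apply is_series_ext with (fun k =>
    sin theta * (INR k * wcos kappa theta k * r ^ k - kappa * (wcos kappa theta k * r ^ k)) +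
    cos theta * (INR k * wsin kappa theta k * r ^ k - kappa * (wsin kappa theta k * r ^ k))).
  { intros k.
    transitivity (INR (S k) * w kappa (S k) * sin (INR (S k) * theta) * r ^ k).
    - real_eq.
      rewrite w_succ, S_INR, Rmult_plus_distr_r, Rmult_1_l, sin_plus.
      unfold wcos, wsin; ring.
    - unfold PS_derive, wsin; real_eq; ring. }
  exact (is_series_plus _ _ _ _ (is_series_scal_l (sin theta) _ _ Ha1)
                                (is_series_scal_l (cos theta) _ _ Hb1)). }
assert (HD : 0 < D) by now apply mod2_one_minus_pos.
pose proof (sin2_cos2 theta) as Hsc; unfold Rsqr in Hsc.
unfold l, p.
set (c := cos theta) in *; set (s := sin theta) in *.
assert (Hu : A' * (1 - r * c) + r * s * B' + kappa * c * A - kappa * s * B = 0) by lra.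
assert (Hv : B' * (1 - r * c) - r * s * A' + kappa * s * A + kappa * c * B = 0) by lra.
assert (Hq : s * s + c * c - 1 = 0) by lra.
(* The two equations are the parts of (1 - r z) F' = - kappa z F with
   z = e^(i theta); the multipliers below are those of its product with
   the conjugate of 1 - r z. *)
split; apply Rmult_eq_reg_l with D; try lra.
- transitivity (kappa * ((r - c) * A + s * B)); [|field; lra].
  transitivity (kappa * ((r - c) * A + s * B)
    + (1 - r * c) * (A' * (1 - r * c) + r * s * B' + kappa * c * A - kappa * s * B)
    - r * s * (B' * (1 - r * c) - r * s * A' + kappa * s * A + kappa * c * B)
    - (r ^ 2 * A' - kappa * r * A) * (s * s + c * c - 1)); [unfold D; fold c; ring|].
  rewrite Hu, Hv, Hq; ring.
- transitivity (kappa * ((r - c) * B - s * A)); [|field; lra].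
  transitivity (kappa * ((r - c) * B - s * A)
    + (1 - r * c) * (B' * (1 - r * c) - r * s * A' + kappa * s * A + kappa * c * B)
    + r * s * (A' * (1 - r * c) + r * s * B' + kappa * c * A - kappa * s * B)
    - (r ^ 2 * B' - kappa * r * B) * (s * s + c * c - 1)); [unfold D; fold c; ring|].
  rewrite Hu, Hv, Hq; ring.
Qed.

(** [exp (log_mod + i arg)] is the principal value of
    (1 - r e^(i theta))^kappa. *)
Definition log_mod (kappa theta r : R) : R :=
  kappa / 2 * ln (1 - 2 * r * cos theta + r ^ 2).
Definition arg (kappa theta r : R) : R :=
  - kappa * atan (r * sin theta / (1 - r * cos theta)).

Lemma binomial_series_disk (kappa theta r : R) : 1 <= kappa <= 2 -> 0 <= r < 1 ->
  PSeries (wcos kappa theta) r = exp (log_mod kappa theta r) * cos (arg kappa theta r) /\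
  PSeries (wsin kappa theta) r = exp (log_mod kappa theta r) * sin (arg kappa theta r).
Proof.
intros Hk Hr.
apply exp_polar_of_ode with
  (l := fun t => kappa * (t - cos theta) / (1 - 2 * t * cos theta + t ^ 2))
  (p := fun t => - kappa * sin theta / (1 - 2 * t * cos theta + t ^ 2));
  try (intros t Ht; assert (Ht1 : 0 <= t < 1) by lra).
- lra.
- rewrite <- (proj1 (binomial_ode kappa theta t Hk Ht1)).
  apply is_derive_PSeries, lt_CV_radius; [now apply ex_series_Rabs_wcos | exact Ht1].
- rewrite <- (proj2 (binomial_ode kappa theta t Hk Ht1)).
  apply is_derive_PSeries, lt_CV_radius; [now apply ex_series_Rabs_wsin | exact Ht1].
- pose proof (mod2_one_minus_pos t theta Ht1) as HD; unfold log_mod.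
  auto_derive; simpl in *; [lra | field; lra].
- pose proof (mod2_one_minus_pos t theta Ht1) as HD; pose proof (re_one_minus_pos t theta Ht1) as H1.
  pose proof (sin2_cos2 theta) as Hsc; unfold Rsqr in Hsc.
  unfold arg; auto_derive; [lra|].
  assert (E : 1 + (t * sin theta / (1 - t * cos theta)) ^ 2 =
              (1 - 2 * t * cos theta + t ^ 2) / (1 - t * cos theta) ^ 2).
  { replace (t ^ 2) with (t ^ 2 * (sin theta * sin theta + cos theta * cos theta))
      by (rewrite Hsc; ring).
    field; lra. }
  simpl in *; unfold Rdiv, Rminus in *; rewrite E; field; lra.
- rewrite PSeries_0; unfold wcos; rewrite w_0; simpl; rewrite Rmult_0_l, cos_0; ring.
- rewrite PSeries_0; unfold wsin; rewrite w_0; simpl; rewrite Rmult_0_l, sin_0; ring.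
- unfold log_mod. replace (1 - _ + _) with 1 by ring. rewrite ln_1; ring.
- unfold arg. rewrite Rmult_0_l. unfold Rdiv; rewrite Rmult_0_l, atan_0; ring.
Qed.

(** * The binomial series on the unit circle *)

Lemma is_series_radial_limit (a : nat -> R) (X : R -> R) (x : R) :
  ex_series (fun k => Rabs (a k)) ->
  (forall r, 0 <= r < 1 -> PSeries a r = X r) ->
  filterlim X (at_left 1) (locally x) ->
  is_series a x.
Proof.
intros Ha HX Hx.
assert (E : Series a = x).
{ rewrite <- PSeries_1.
  apply (filterlim_locally_unique (F := at_left 1) (PSeries a)).
  - now apply PSeries_lim_1.
  - apply filterlim_ext_loc with X; [|exact Hx].
    exists (mkposreal 1 Rlt_0_1); intros r Hr Hr1; symmetry; apply HX.
    apply Rabs_def2 in Hr; unfold minus, plus, opp in Hr; simpl in Hr; lra. }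
rewrite <- E; apply Series_correct, ex_series_Rabs, Ha.
Qed.

(** At theta = 0 the polar form degenerates at r = 1. There the sum is
    the limit of (1 - r)^kappa, which is at most 1 - r since [kappa >= 1]. *)
Lemma binomial_series_at_0 (kappa : R) : 1 <= kappa <= 2 -> is_series (w kappa) 0.
Proof.
intros Hk.
apply is_series_ext with (wcos kappa 0).
{ intros n; unfold wcos; rewrite Rmult_0_r, cos_0; apply Rmult_1_r. }
apply is_series_radial_limit with (X := fun r => PSeries (wcos kappa 0) r);
  [now apply ex_series_Rabs_wcos | reflexivity |].
intros S [eps HS]; exists (mkposreal (Rmin 1 eps) (Rmin_pos _ _ Rlt_0_1 (cond_pos eps))).
intros r Hr Hr1; apply HS.
assert (H01 : 0 <= r < 1 /\ 1 - r < eps).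
{ change (Rabs (r - 1) < Rmin 1 eps) in Hr.
  pose proof (Rmin_l 1 eps); pose proof (Rmin_r 1 eps).
  apply Rabs_def2 in Hr; lra. }
change (Rabs (PSeries (wcos kappa 0) r - 0) < eps).
rewrite Rminus_0_r, (proj1 (binomial_series_disk kappa 0 r Hk (proj1 H01))).
eapply Rle_lt_trans; [apply Rabs_mult_le_l, Rabs_cos_le_1|].
rewrite Rabs_pos_eq by apply Rlt_le, exp_pos.
apply Rle_lt_trans with (1 - r); [|lra].
unfold log_mod; rewrite cos_0.
replace (1 - 2 * r * 1 + r ^ 2) with ((1 - r) * (1 - r)) by ring.
rewrite ln_mult by lra.
rewrite <- (exp_ln (1 - r)) at 3 by lra.
assert (Hln : ln (1 - r) <= 0).
{ rewrite <- ln_1; destruct (Req_dec r 0) as [->|]; [rewrite Rminus_0_r; lra|].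
  apply Rlt_le, ln_increasing; lra. }
assert (Hle : kappa / 2 * (ln (1 - r) + ln (1 - r)) <= ln (1 - r)) by nra.
destruct Hle as [Hlt|Heq]; [apply Rlt_le, exp_increasing, Hlt | rewrite Heq; lra].
Qed.

Lemma log_mod_1 (kappa theta : R) : 0 < sin (theta / 2) ->
  log_mod kappa theta 1 = kappa * ln (2 * sin (theta / 2)).
Proof.
intros Hs; unfold log_mod.
replace theta with (2 * (theta / 2)) at 1 by field.
rewrite cos_2a_sin.
replace (1 - _ + _) with (2 * sin (theta / 2) * (2 * sin (theta / 2))) by ring.
rewrite ln_mult by lra; field.
Qed.

Lemma arg_1 (kappa theta : R) : 0 < theta <= PI ->
  arg kappa theta 1 = kappa / 2 * (theta - PI).
Proof.
intros Ht; unfold arg.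
assert (Hs : 0 < sin (theta / 2)) by (apply sin_gt_0; lra).
replace (1 * sin theta / (1 - 1 * cos theta)) with (tan (PI / 2 - theta / 2)).
- rewrite atan_tan by lra; field.
- unfold tan; rewrite sin_shift, cos_shift.
  replace theta with (2 * (theta / 2)) at 3 4 by field.
  rewrite cos_2a_sin, sin_2a; field; split; nra.
Qed.

(** Real part of (1 - z)^kappa e^(i psi) for z = e^(i theta). The free phase
    [psi] lets the three terms of Q be read off with psi = - theta, 0, theta. *)
Lemma binomial_series_circle (kappa theta psi : R) :
  1 <= kappa <= 2 -> 0 <= theta <= PI ->
  is_series (fun k => w kappa k * cos (INR k * theta + psi))
    (rpow (2 * sin (theta / 2)) kappa * cos (kappa / 2 * (theta - PI) + psi)).
Proof.
intros Hk Ht; unfold rpow.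
destruct (Req_dec theta 0) as [->|Hn].
- replace (0 / 2) with 0 by field; rewrite sin_0, Rmult_0_r.
  destruct (Rlt_dec 0 0) as [Hf|_]; [lra|].
  replace (0 * cos _) with (cos psi * 0) by ring.
  apply is_series_ext with (fun k => cos psi * w kappa k).
  { intros n; rewrite Rmult_0_r, Rplus_0_l; apply Rmult_comm. }
  exact (is_series_scal_l (cos psi) _ _ (binomial_series_at_0 kappa Hk)).
- assert (Hs : 0 < sin (theta / 2)) by (apply sin_gt_0; lra).
  destruct (Rlt_dec 0 (2 * sin (theta / 2))) as [_|Hf]; [|lra].
  assert (Hc : 0 < 1 - cos theta).
  { replace theta with (2 * (theta / 2)) by field; rewrite cos_2a_sin; nra. }
  unfold Rpower.
  rewrite <- (log_mod_1 kappa theta Hs), <- (arg_1 kappa theta) by lra.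
  assert (HA : is_series (wcos kappa theta)
                 (exp (log_mod kappa theta 1) * cos (arg kappa theta 1))).
  { apply (is_series_radial_limit _
      (fun r => exp (log_mod kappa theta r) * cos (arg kappa theta r))).
    - now apply ex_series_Rabs_wcos.
    - intros r Hr; exact (proj1 (binomial_series_disk kappa theta r Hk Hr)).
    - apply (filterlim_at_left_of_continuous
        (fun r => exp (log_mod kappa theta r) * cos (arg kappa theta r))).
      apply (ex_derive_continuous (K := R_AbsRing) (V := R_NormedModule)).
      unfold log_mod, arg; auto_derive; simpl; split; lra. }
  assert (HB : is_series (wsin kappa theta)
                 (exp (log_mod kappa theta 1) * sin (arg kappa theta 1))).
  { apply (is_series_radial_limit _
      (fun r => exp (log_mod kappa theta r) * sin (arg kappa theta r))).
    - now apply ex_series_Rabs_wsin.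
    - intros r Hr; exact (proj2 (binomial_series_disk kappa theta r Hk Hr)).
    - apply (filterlim_at_left_of_continuous
        (fun r => exp (log_mod kappa theta r) * sin (arg kappa theta r))).
      apply (ex_derive_continuous (K := R_AbsRing) (V := R_NormedModule)).
      unfold log_mod, arg; auto_derive; simpl; split; lra. }
  rewrite cos_plus.
  replace (exp (log_mod kappa theta 1) *
      (cos (arg kappa theta 1) * cos psi - sin (arg kappa theta 1) * sin psi))
    with (cos psi * (exp (log_mod kappa theta 1) * cos (arg kappa theta 1)) -
          sin psi * (exp (log_mod kappa theta 1) * sin (arg kappa theta 1))) by ring.
  apply is_series_ext with
    (fun k => cos psi * wcos kappa theta k - sin psi * wsin kappa theta k).
  { intros n; rewrite cos_plus; unfold wcos, wsin; real_eq; ring. }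
  exact (is_series_minus _ _ _ _ (is_series_scal_l (cos psi) _ _ HA)
                                 (is_series_scal_l (sin psi) _ _ HB)).
Qed.

Lemma is_series_delay (a : nat -> R) (l : R) :
  is_series a l -> is_series (PS_incr_1 a) l.
Proof.
intros H; apply is_series_decr_1.
change (is_series a (l + - 0)); rewrite Ropp_0, Rplus_0_r; exact H.
Qed.

(** The weights [g] superpose [w] delayed by 0, 1 and 2 steps; measured from the
    centre k = 1 of the stencil, the delays are the phases - theta, 0, theta. *)
Lemma is_series_g_cos (kappa theta : R) (mu : triple) :
  1 <= kappa <= 2 -> 0 <= theta <= PI ->
  is_series (fun k => g kappa mu k * cos ((INR k - 1) * theta)) (Q theta kappa mu).
Proof.
intros Hk Ht.
pose proof (binomial_series_circle kappa theta (- theta) Hk Ht) as H1.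
pose proof (is_series_delay _ _ (binomial_series_circle kappa theta 0 Hk Ht)) as H2.
pose proof (is_series_delay _ _ (is_series_delay _ _
  (binomial_series_circle kappa theta theta Hk Ht))) as H3.
pose proof (is_series_plus _ _ _ _ (is_series_plus _ _ _ _
  (is_series_scal_l (mu1 mu) _ _ H1) (is_series_scal_l (mu2 mu) _ _ H2))
  (is_series_scal_l (mu3 mu) _ _ H3)) as H.
match type of H with is_series _ ?l => replace (Q theta kappa mu) with l end.
- revert H; apply is_series_ext; intros [|[|k]]; simpl PS_incr_1; unfold g.
  + real_eq.
    change (mu1 mu * (w kappa 0 * cos (INR 0 * theta + - theta)) + mu2 mu * 0 + mu3 mu * 0
      = mu1 mu * w kappa 0 * cos ((INR 0 - 1) * theta)).
    replace (INR 0 * theta + - theta) with ((INR 0 - 1) * theta) by ring; ring.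
  + change (mu1 mu * (w kappa 1 * cos (INR 1 * theta + - theta)) +
      mu2 mu * (w kappa 0 * cos (INR 0 * theta + 0)) + mu3 mu * 0
      = (mu1 mu * w kappa 1 + mu2 mu * w kappa 0) * cos ((INR 1 - 1) * theta)).
    replace (INR 1 * theta + - theta) with ((INR 1 - 1) * theta) by ring.
    replace (INR 0 * theta + 0) with ((INR 1 - 1) * theta) by (simpl; ring); ring.
  + change (mu1 mu * (w kappa (S (S k)) * cos (INR (S (S k)) * theta + - theta)) +
      mu2 mu * (w kappa (S k) * cos (INR (S k) * theta + 0)) +
      mu3 mu * (w kappa k * cos (INR k * theta + theta))
      = (mu1 mu * w kappa (S (S k)) + mu2 mu * w kappa (S k) + mu3 mu * w kappa k) *
        cos ((INR (S (S k)) - 1) * theta)).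
    rewrite !S_INR.
    replace ((INR k + 1 + 1) * theta + - theta) with ((INR k + 1 + 1 - 1) * theta) by ring.
    replace ((INR k + 1) * theta + 0) with ((INR k + 1 + 1 - 1) * theta) by ring.
    replace (INR k * theta + theta) with ((INR k + 1 + 1 - 1) * theta) by ring.
    ring.
- unfold Q; rewrite Rplus_0_r; change plus with Rplus; change scal with Rmult.
  unfold Rminus; real_eq; ring.
Qed.

(** * Fourier symbols *)

Definition expi (x : R) : C := (cos x, sin x).

Lemma expi_plus (x y : R) : expi (x + y) = (expi x * expi y)%C.
Proof.
unfold expi, Cmult; simpl; rewrite cos_plus, sin_plus; f_equal; ring.
Qed.

Lemma expi_plus_opp (x : R) : (expi (- x) + expi x = RtoC (2 * cos x))%C.
Proof.
unfold expi, Cplus, RtoC; simpl; rewrite cos_neg, sin_neg; f_equal; ring.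
Qed.

Lemma CSeries_RtoC_scal (x : nat -> R) (z : C) :
  CSeries (fun k => RtoC (x k) * z)%C = (RtoC (Series x) * z)%C.
Proof.
unfold CSeries, Cmult, RtoC; simpl.
f_equal; rewrite ?Rmult_0_l, ?Rminus_0_r, ?Rplus_0_r, <- Series_scal_r;
  apply Series_ext; intros n; ring.
Qed.

Lemma CSeries_ext (x y : nat -> C) :
  (forall k, x k = y k) -> CSeries x = CSeries y.
Proof.
intros H; unfold CSeries; f_equal; apply Series_ext; intros k; now rewrite H.
Qed.

(** Eigenvalue of [delta1] on e^(i theta j). [Rabs theta] appears because the
    diffusion part is even in theta whereas Q is the sum of the cosine series
    only on [0, PI]. *)
Definition symbol (d v kappa : R) (mu : triple) (h theta : R) : C :=
  (2 * (d / Rpower h kappa) * Q (Rabs theta) kappa mu, - (v * sin theta / h)).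

Lemma delta1_eigen (d v kappa : R) (mu : triple) (h theta : R) (u : Z -> C) (j : Z) :
  1 <= kappa <= 2 -> 0 < h -> - PI <= theta <= PI ->
  (forall k : Z, u (j + k)%Z = (expi (theta * IZR k) * u j)%C) ->
  delta1 d v kappa mu h u j = (symbol d v kappa mu h theta * u j)%C.
Proof.
intros Hk Hh Ht Hu; unfold delta1.
rewrite (CSeries_ext _ (fun k =>
  RtoC (g kappa mu k * cos ((INR k - 1) * Rabs theta)) * (RtoC 2 * u j))%C).
- rewrite CSeries_RtoC_scal.
  rewrite (is_series_unique _ _ (is_series_g_cos kappa (Rabs theta) mu Hk
    (conj (Rabs_pos theta) (Rabs_le _ _ Ht)))).
  replace (j - 1)%Z with (j + -1)%Z by lia; rewrite !Hu.
  destruct (u j) as [x y].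
  unfold symbol, expi, Cmult, Cminus, Cplus, Copp, Cdiv, Cinv, RtoC; simpl.
  replace (theta * -1) with (- theta) by ring; rewrite Rmult_1_r, cos_neg, sin_neg.
  f_equal; field; split; try lra; apply Rgt_not_eq, exp_pos.
- intros k.
  replace (j - Z.of_nat k + 1)%Z with (j + - (Z.of_nat k - 1))%Z by lia.
  replace (j + Z.of_nat k - 1)%Z with (j + (Z.of_nat k - 1))%Z by lia.
  rewrite !Hu, opp_IZR, minus_IZR, <- INR_IZR_INZ.
  replace (theta * - (INR k - 1)) with (- (theta * (INR k - 1))) by ring.
  replace (cos ((INR k - 1) * Rabs theta)) with (cos (theta * (INR k - 1))).
  + rewrite <- Cmult_plus_distr_r, expi_plus_opp, !RtoC_mult; ring.
  + unfold Rabs; destruct (Rcase_abs theta); [rewrite <- cos_neg|]; f_equal; ring.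
Qed.

(** Modes are described by their behaviour under translation: this is stable
    under scalar multiples, hence under the operators, so these can be composed
    without returning to an explicit formula. *)
Definition is_mode (thx thy : R) (U : grid) : Prop :=
  forall j m k : Z,
    U (j + k)%Z m = (expi (thx * IZR k) * U j m)%C /\
    U j (m + k)%Z = (expi (thy * IZR k) * U j m)%C.

Lemma is_mode_scal (thx thy : R) (z : C) (U V : grid) :
  is_mode thx thy U -> (forall j m, V j m = (z * U j m)%C) -> is_mode thx thy V.
Proof.
intros HU HV j m k; rewrite !HV, (proj1 (HU j m k)), (proj2 (HU j m k)).
split; ring.
Qed.

Lemma id_plus_delta_x (c dx vx alpha : R) (lam : triple) (h thx thy : R) (U : grid) (j m : Z) :
  1 <= alpha <= 2 -> 0 < h -> - PI <= thx <= PI -> is_mode thx thy U ->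
  id_plus c (delta_x dx vx alpha lam h) U j m =
  ((1 + RtoC c * symbol dx vx alpha lam h thx) * U j m)%C.
Proof.
intros Ha Hh Ht HU; unfold id_plus, delta_x.
rewrite (delta1_eigen dx vx alpha lam h thx); try assumption.
- ring.
- intros k; apply HU.
Qed.

Lemma id_plus_delta_y (c dy vy beta : R) (gam : triple) (h thx thy : R) (U : grid) (j m : Z) :
  1 <= beta <= 2 -> 0 < h -> - PI <= thy <= PI -> is_mode thx thy U ->
  id_plus c (delta_y dy vy beta gam h) U j m =
  ((1 + RtoC c * symbol dy vy beta gam h thy) * U j m)%C.
Proof.
intros Ha Hh Ht HU; unfold id_plus, delta_y.
rewrite (delta1_eigen dy vy beta gam h thy); try assumption.
- ring.
- intros k; apply HU.
Qed.

Lemma fourier_mode_is_mode (rho : C) (thx thy : R) (n : nat) :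
  is_mode thx thy (fourier_mode rho thx thy n).
Proof.
intros j m k; unfold fourier_mode; cbv zeta.
change (cos ?x, sin ?x) with (expi x).
rewrite !plus_IZR; split.
- replace (thx * (IZR j + IZR k) + thy * IZR m)
    with (thx * IZR k + (thx * IZR j + thy * IZR m)) by ring.
  rewrite expi_plus; ring.
- replace (thx * IZR j + thy * (IZR m + IZR k))
    with (thy * IZR k + (thx * IZR j + thy * IZR m)) by ring.
  rewrite expi_plus; ring.
Qed.

(** * Stability *)

Lemma one_minus_neq_0 (c : R) (s : C) :
  0 <= c -> Re s <= 0 -> (1 + RtoC (- c) * s)%C <> 0%C.
Proof.
intros Hc Hs H; apply (f_equal Re) in H; destruct s as [x y]; simpl in *; nra.
Qed.

(** The squares of the two moduli differ by 4 c Re s. *)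
Lemma Cmod_one_plus_le (c : R) (s : C) :
  0 <= c -> Re s <= 0 -> Cmod (1 + RtoC c * s) <= Cmod (1 + RtoC (- c) * s).
Proof.
intros Hc Hs; unfold Cmod; apply sqrt_le_1_alt; destruct s as [x y]; simpl in *; nra.
Qed.

Lemma Re_symbol_le_0 (d v kappa : R) (mu : triple) (h theta : R) :
  0 <= d -> Q (Rabs theta) kappa mu <= 0 -> Re (symbol d v kappa mu h theta) <= 0.
Proof.
intros Hd HQ; simpl.
assert (0 <= d / Rpower h kappa).
{ apply Rmult_le_pos; [exact Hd | apply Rlt_le, Rinv_0_lt_compat, exp_pos]. }
nra.
Qed.

Theorem theorem6 :
  forall (dx dy vx vy : R),
  0 <= dx -> 0 <= dy -> 0 < vx -> 0 < vy ->
  forall (lam gam : R -> triple),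
  (forall alpha : R, 1 < alpha <= 2 ->
     S1 alpha (lam alpha) \/ S2 alpha (lam alpha) \/ S3 alpha (lam alpha)) ->
  (forall beta : R, 1 < beta <= 2 ->
     S1 beta (gam beta) \/ S2 beta (gam beta) \/ S3 beta (gam beta)) ->
  (forall alpha beta : R, 1 < alpha <= 2 -> 1 < beta <= 2 ->
   forall thx thy : R, 0 <= thx <= PI -> 0 <= thy <= PI ->
     Q thx alpha (lam alpha) <= 0 /\ Q thy beta (gam beta) <= 0) ->
  forall alpha beta : R, 1 < alpha <= 2 -> 1 < beta <= 2 ->
  unconditionally_stable dx dy vx vy alpha beta (lam alpha) (gam beta).
Proof.
intros dx dy vx vy Hdx Hdy _ _ lam gam _ _ HQ alpha beta Ha Hb
  tau h Htau Hh thx thy Hthx Hthy.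
destruct (HQ alpha beta Ha Hb (Rabs thx) (Rabs thy)
  (conj (Rabs_pos _) (Rabs_le _ _ Hthx)) (conj (Rabs_pos _) (Rabs_le _ _ Hthy)))
  as [HQx HQy].
pose proof (Re_symbol_le_0 dx vx alpha (lam alpha) h thx Hdx HQx) as Hsx.
pose proof (Re_symbol_le_0 dy vy beta (gam beta) h thy Hdy HQy) as Hsy.
assert (Ha1 : 1 <= alpha <= 2) by lra.
assert (Hb1 : 1 <= beta <= 2) by lra.
assert (Hfactor : forall c n rho j m,
  id_plus c (delta_x dx vx alpha (lam alpha) h)
    (id_plus c (delta_y dy vy beta (gam beta) h) (fourier_mode rho thx thy n)) j m =
  ((1 + RtoC c * symbol dx vx alpha (lam alpha) h thx) *
   (1 + RtoC c * symbol dy vy beta (gam beta) h thy) *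
   fourier_mode rho thx thy n j m)%C).
{ intros c n rho j m.
  pose proof (fourier_mode_is_mode rho thx thy n) as Hm.
  pose proof (fun j m => id_plus_delta_y c dy vy beta (gam beta) h thx thy _ j m
    Hb1 Hh Hthy Hm) as Hy.
  rewrite (id_plus_delta_x c dx vx alpha (lam alpha) h thx thy _ j m
    Ha1 Hh Hthx (is_mode_scal _ _ _ _ _ Hm Hy)).
  rewrite Hy; ring. }
assert (Hc : 0 <= tau / 2) by lra.
pose proof (one_minus_neq_0 _ _ Hc Hsx) as Nx.
pose proof (one_minus_neq_0 _ _ Hc Hsy) as Ny.
pose proof (Cmod_one_plus_le _ _ Hc Hsx) as Lx.
pose proof (Cmod_one_plus_le _ _ Hc Hsy) as Ly.
set (px := (1 + RtoC (tau / 2) * symbol dx vx alpha (lam alpha) h thx)%C) in *.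
set (py := (1 + RtoC (tau / 2) * symbol dy vy beta (gam beta) h thy)%C) in *.
set (mx := (1 + RtoC (- (tau / 2)) * symbol dx vx alpha (lam alpha) h thx)%C) in *.
set (my := (1 + RtoC (- (tau / 2)) * symbol dy vy beta (gam beta) h thy)%C) in *.
pose proof (Cmult_neq_0 _ _ Nx Ny) as N.
exists (px * py / (mx * my))%C; split.
- intros rho; split.
  (* At n = 0 and the origin the mode is 1 and its successor is rho. *)
  + intros H; specialize (H 0%nat 0%Z 0%Z); rewrite !Hfactor in H.
    fold px py mx my in H.
    unfold fourier_mode in H; simpl in H.
    rewrite !Rmult_0_r, Rplus_0_r, cos_0, sin_0 in H; change (1, 0) with (RtoC 1) in H.
    rewrite !Cmult_1_r, Cmult_0_r, Cplus_0_r in H.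
    unfold Cdiv; rewrite <- H; field; split; assumption.
  + intros -> n j m; rewrite !Hfactor; fold px py mx my.
    unfold fourier_mode; cbv zeta; rewrite Cpow_S; field; split; assumption.
- rewrite Cmod_div by exact N; rewrite !Cmod_mult.
  apply Rmult_le_reg_r with (Cmod mx * Cmod my).
  + apply Rmult_lt_0_compat; now apply Cmod_gt_0.
  + unfold Rdiv; rewrite Rmult_assoc, Rinv_l, Rmult_1_r, Rmult_1_l.
    * apply Rmult_le_compat; try apply Cmod_ge_0; assumption.
    * apply Rmult_integral_contrapositive_currified; apply Rgt_not_eq; now apply Cmod_gt_0.
Qed.
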